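(* The variety $\mathcal{M}_{DM}$ of modular lattices with De Morgan complementation has uncountably many subvarieties.
   Context: A lattice with complementation is an algebra $(L,\vee,\wedge,{}',0,1)$ of type $(2,2,1,0,0)$ such that $(L,\vee,\wedge,0,1)$ is a bounded lattice and $a\vee a'=1$, $a\wedge a'=0$ for all $a\in L$. $\mathcal{M}_{DM}$ is the variety of lattices with complementation whose lattice reduct is modular and which satisfy De Morgan's laws $(x\vee y)'\approx x'\wedge y'$ and $(x\wedge y)'\approx x'\vee y'$ (the complementation need not be involutive). *)

(* Defs.v *)
From mathcomp Require Import all_boot.
From mathcomp Require Import boolp classical_sets functions cardinality.

Set Implicit Arguments.
Unset Strict Implicit.
Unset Printing Implicit Defensive.

Local Open Scope classical_set_scope.

(* Algebras of type (2,2,1,0,0). No axiom is imposed here: classes of algebras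
   are sets of such structures. *)
Record algebra : Type := Algebra {
  carrier :> Type;
  join : carrier -> carrier -> carrier;
  meet : carrier -> carrier -> carrier;
  compl : carrier -> carrier;
  zero : carrier;
  one : carrier }.

Arguments zero A : rename.
Arguments one A : rename.

Inductive term : Type :=
  | TVar of nat
  | TJoin of term & term
  | TMeet of term & term
  | TCompl of term
  | TZero
  | TOne.

Fixpoint eval (A : algebra) (v : nat -> A) (t : term) : A :=
  match t with
  | TVar i => v i
  | TJoin s u => join (eval v s) (eval v u)
  | TMeet s u => meet (eval v s) (eval v u)
  | TCompl s => compl (eval v s)
  | TZero => zero A
  | TOne => one A
  end.

Definition identity : Type := (term * term)%type.

Definition satisfies (A : algebra) (e : identity) : Prop :=
  forall v : nat -> A, eval v e.1 = eval v e.2.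

Definition models (E : set identity) : set algebra :=
  [set A | forall e, E e -> satisfies A e].

Definition is_variety (V : set algebra) : Prop :=
  exists E : set identity, V = models E.

Definition is_subvariety (V W : set algebra) : Prop :=
  is_variety V /\ V `<=` W.

Record is_bounded_lattice (A : algebra) : Prop := {
  joinC : forall x y : A, join x y = join y x;
  meetC : forall x y : A, meet x y = meet y x;
  joinA : forall x y z : A, join x (join y z) = join (join x y) z;
  meetA : forall x y z : A, meet x (meet y z) = meet (meet x y) z;
  join_absorb : forall x y : A, join x (meet x y) = x;
  meet_absorb : forall x y : A, meet x (join x y) = x;
  join_zero : forall x : A, join x (zero A) = x;
  meet_one : forall x : A, meet x (one A) = x }.

Record is_lattice_with_complementation (A : algebra) : Prop := {
  lc_bounded_lattice : is_bounded_lattice A;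
  join_compl : forall x : A, join x (compl x) = one A;
  meet_compl : forall x : A, meet x (compl x) = zero A }.

Definition lat_le (A : algebra) (x y : A) : Prop := meet x y = x.

Definition is_modular (A : algebra) : Prop :=
  forall x y z : A, lat_le x z -> join x (meet y z) = meet (join x y) z.

Record is_de_morgan (A : algebra) : Prop := {
  compl_join : forall x y : A, compl (join x y) = meet (compl x) (compl y);
  compl_meet : forall x y : A, compl (meet x y) = join (compl x) (compl y) }.

Definition M_DM : set algebra :=
  [set A | [/\ is_lattice_with_complementation A, is_modular A
             & is_de_morgan A]].

(* Main.v *)
Require Import Defs.
From mathcomp Require Import all_boot.
From mathcomp Require Import boolp classical_sets functions cardinality.

Set Implicit Arguments.
Unset Strict Implicit.
Unset Printing Implicit Defensive.

Local Open Scope classical_set_scope.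

(** An injective fixed-point-free map [f] on the atoms of a lattice of height 2
    is a De Morgan complementation.  Let [A_p] be the case where [f] is a single
    cycle of odd prime length [p].  In [A_p] the identity
    [x /\ x^(q) = 0], with [q] complementations, holds at 0 and 1 because [q] is
    odd, and at an atom [x] unless [f^q x = x]; so for [q] prime it fails
    exactly when [q = p].  Hence the subvarieties cut out by different sets of
    these identities differ. *)

(** With all identities valid in [M_DM] as axioms, one inclusion is immediate. For the other, each
    defining condition is an instance of such an identity. *)
Lemma M_DM_variety : is_variety M_DM.
Proof.
exists [set e | forall A, M_DM A -> satisfies A e].
apply/seteqP; split=> [A HA e|A HA]; first exact.
(* The default value of [nth] serves as the last variable: here variable 0 is [x] and all others are
   [y]. *)
have ax2 s t (x y : A) :
    (forall B, M_DM B -> satisfies B (s, t)) ->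
    eval (nth y [:: x]) s = eval (nth y [:: x]) t.
  by move=> /HA; apply.
have ax3 s t (x y z : A) :
    (forall B, M_DM B -> satisfies B (s, t)) ->
    eval (nth z [:: x; y]) s = eval (nth z [:: x; y]) t.
  by move=> /HA; apply.
pose X := TVar 0; pose Y := TVar 1; pose Z := TVar 2.
split; [split; [split|..]|..|split].
- move=> x y; apply: (ax2 (TJoin X Y) (TJoin Y X)).
  by move=> B [[[]]] *; move=> v /=.
- move=> x y; apply: (ax2 (TMeet X Y) (TMeet Y X)).
  by move=> B [[[]]] *; move=> v /=.
- move=> x y z; apply: (ax3 (TJoin X (TJoin Y Z)) (TJoin (TJoin X Y) Z)).
  by move=> B [[[]]] *; move=> v /=.
- move=> x y z; apply: (ax3 (TMeet X (TMeet Y Z)) (TMeet (TMeet X Y) Z)).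
  by move=> B [[[]]] *; move=> v /=.
- move=> x y; apply: (ax2 (TJoin X (TMeet X Y)) X).
  by move=> B [[[]]] *; move=> v /=.
- move=> x y; apply: (ax2 (TMeet X (TJoin X Y)) X).
  by move=> B [[[]]] *; move=> v /=.
- move=> x; apply: (ax2 (TJoin X TZero) X x x).
  by move=> B [[[]]] *; move=> v /=.
- move=> x; apply: (ax2 (TMeet X TOne) X x x).
  by move=> B [[[]]] *; move=> v /=.
- move=> x; apply: (ax2 (TJoin X (TCompl X)) TOne x x).
  by move=> B [[]] *; move=> v /=.
- move=> x; apply: (ax2 (TMeet X (TCompl X)) TZero x x).
  by move=> B [[]] *; move=> v /=.
- move=> x y z xz.
  (* Modularity as an identity: [x <= z] is encoded by replacing [x] with
     [x /\ z]. *)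
  have := @ax3 (TJoin (TMeet X Z) (TMeet Y Z))
               (TMeet (TJoin (TMeet X Z) Y) Z) x y z.
  rewrite /= xz; apply=> B [[[_ mC _ mA ja ma _ _] _ _] modB _] v /=.
  apply: modB; rewrite /lat_le -mA; congr meet.
  (* Idempotence from the two absorption laws: [z /\ z = z /\ (z \/ (z /\ z)) = z]. *)
  by rewrite -{2}(ja (v 2) (v 2)) ma.
- move=> x y; apply: (ax2 (TCompl (TJoin X Y)) (TMeet (TCompl X) (TCompl Y))).
  by move=> B [_ _ []] *; move=> v /=.
- move=> x y; apply: (ax2 (TCompl (TMeet X Y)) (TJoin (TCompl X) (TCompl Y))).
  by move=> B [_ _ []] *; move=> v /=.
Qed.

(* The ordinal type ['I_n] lives in a universe too large for [algebra]. *)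
Notation cyc n := {i : nat | i < n}.

Definition cycS n (i : cyc n) : cyc n :=
  exist _ ((sval i).+1 %% n) (ltn_pmod _ (leq_ltn_trans (leq0n _) (svalP i))).

Lemma cycS_inj n : injective (@cycS n).
Proof.
move=> [i lt_in] [j lt_jn] [] /eqP; rewrite -(addn1 i) -(addn1 j) eqn_modDr.
by rewrite !modn_small // => /eqP eq_ij; apply: val_inj.
Qed.

Lemma val_iter_cycS n k (i : cyc n) :
  sval (iter k (@cycS n) i) = (sval i + k) %% n.
Proof.
elim: k => [|k IHk]; first by rewrite addn0 modn_small ?(svalP i).
by rewrite iterS [LHS]/= IHk -addn1 modnDml addn1 addnS.
Qed.

(** A power of a full cycle is the identity or has no fixed point: [i] cancels from [i + 0 = i + k]
    modulo [n]. *)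
Lemma iter_cycS_eq n k (i : cyc n) : (i == iter k (@cycS n) i) = (n %| k).
Proof.
rewrite -val_eqE [val (iter _ _ _)]val_iter_cycS.
by rewrite -[val i in LHS](modn_small (svalP i)) -[X in X %% n == _]addn0
  eqn_modDl mod0n eq_sym.
Qed.

(** The carrier of the modular lattice usually written [M_n]. *)
Inductive height2 (n : nat) : Set := Bot | Top | Atom of cyc n.

Arguments Bot {n}.
Arguments Top {n}.
Arguments Atom {n} _.

Section CyclicAlgebra.
Variable n : nat.
Implicit Types (a : cyc n) (x y : height2 n).

Definition join2 x y : height2 n :=
  match x, y with
  | Bot, z | z, Bot => z
  | Atom a, Atom b => if a == b then Atom a else Top
  | _, _ => Top
  end.

Definition meet2 x y : height2 n :=
  match x, y with
  | Top, z | z, Top => z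
  | Atom a, Atom b => if a == b then Atom a else Bot
  | _, _ => Bot
  end.

Definition compl2 x : height2 n :=
  match x with Bot => Top | Top => Bot | Atom a => Atom (cycS a) end.

Definition cyclic_algebra : algebra :=
  Algebra (carrier := height2 n) join2 meet2 compl2 Bot Top.

Lemma iter_compl2_Atom k a : iter k compl2 (Atom a) = Atom (iter k (@cycS n) a).
Proof. by elim: k => //= k ->. Qed.

Lemma iter_compl2_Top k : iter k compl2 Top = if odd k then Bot else Top.
Proof. by elim: k => //= k ->; case: odd. Qed.

Lemma cyclic_algebra_M_DM : 1 < n -> M_DM cyclic_algebra.
Proof.
move=> n_gt1.
have free a : (a == cycS a) = false.
  by rewrite (iter_cycS_eq 1) dvdn1 gtn_eqF.
split; [split; [split|..]|..|split] => /=.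
- by case=> [||a] [||b] //=; case: (eqVneq a b) => [->|//].
- by case=> [||a] [||b] //=; case: (eqVneq a b) => [->|//].
- case=> [||a] [||b] [||c] //=;
    repeat (case: eqVneq => [?|/eqP ?] //=; subst); congruence.
- case=> [||a] [||b] [||c] //=;
    repeat (case: eqVneq => [?|/eqP ?] //=; subst); congruence.
- by case=> [||a] [||b] //=; rewrite ?eqxx //;
    case: eqVneq => //=; rewrite eqxx.
- by case=> [||a] [||b] //=; rewrite ?eqxx //;
    case: eqVneq => //=; rewrite eqxx.
- by case.
- by case.
- by case=> [||a] //=; rewrite free.
- by case=> [||a] //=; rewrite free.
- case=> [||a] [||b] [||c] //; rewrite /lat_le /=;
    repeat (case: eqVneq => [?|/eqP ?] //=; subst); congruence.
(* By injectivity, two atoms are distinct exactly when their complements are, so both sides of De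
   Morgan's law fall into the same case. *)
- by case=> [||a] [||b] //=; rewrite (inj_eq (@cycS_inj n)); case: eqVneq.
- by case=> [||a] [||b] //=; rewrite (inj_eq (@cycS_inj n)); case: eqVneq.
Qed.

End CyclicAlgebra.

Definition cycle_identity (k : nat) : identity :=
  (TMeet (TVar 0) (iter k TCompl (TVar 0)), TZero).

Lemma cyclic_algebra_cycle_identity n k : 0 < n -> odd k ->
  satisfies (cyclic_algebra n) (cycle_identity k) <-> ~~ (n %| k).
Proof.
move=> n_gt0 odd_k.
have evalE (v : nat -> cyclic_algebra n) :
    eval v (cycle_identity k).1 =
    meet2 (v 0) (iter k (@compl2 n) (v 0)).
  by rewrite /=; congr meet2; elim: k {odd_k} => //= k ->.
(* Any atom would do as a test, since [iter_cycS_eq] does not depend on it; [0 < n] supplies the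
   atom 0. *)
split=> [/(_ (fun=> Atom (exist _ 0 n_gt0)))|n_k v]; rewrite evalE.
  by rewrite iter_compl2_Atom /= iter_cycS_eq; case: (n %| k).
case: (v 0) => [||a]; first by case: (iter _ _ _).
  by rewrite iter_compl2_Top odd_k.
by rewrite iter_compl2_Atom /= iter_cycS_eq (negbTE n_k).
Qed.

Lemma odd_primes_sequence :
  exists p : nat -> nat, injective p /\ forall i, prime (p i) /\ odd (p i).
Proof.
(* Each prime exceeds the previous one, which gives injectivity; starting above 2 makes all of them
   odd. *)
pose p := fix p i := s2val (prime_above (if i is j.+1 then p j else 2)).
have p_incr : {homo p : i j / i < j}.
  apply: homo_ltn => [? ? ?|i]; first exact: ltn_trans.
  by rewrite [p i.+1]/=; case: prime_above.
have p_gt2 i : 2 < p i.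
  elim: i => [|i IHi]; first by rewrite /p; case: prime_above.
  exact: ltn_trans IHi (p_incr _ _ (ltnSn i)).
exists p; split=> [i j pij|i].
  by case: (ltngtP i j) => // /p_incr; rewrite pij ltnn.
have p_prime : prime (p i) by case: i => [|i] /=; case: prime_above.
split=> //; case: (even_prime p_prime) => // pi2.
by have := p_gt2 i; rewrite pi2.
Qed.

Lemma subvariety_cut V E :
  is_variety V -> is_subvariety (V `&` models E) V.
Proof.
move=> [F ->]; split; last by move=> A [].
exists (F `|` E); apply/seteqP; split=> [A [AF AE] e [/AF|/AE]|A AFE] //.
by split=> e ?; apply: AFE; [left|right].
Qed.

(** Cantor's diagonal argument: [S0] collects the codes [g (h S)] that do not belong to the set [S]
    they encode. *)
Lemma powerset_nat_not_countable (T : Type) (D : set T) (h : set nat -> T) :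
  injective h -> (forall S, D (h S)) -> ~ countable D.
Proof.
move=> h_inj hD /countable_injP[g g_inj].
pose S0 := [set m | exists2 S : set nat, m = g (h S) & ~ S m].
have S0P : S0 (g (h S0)) <-> ~ S0 (g (h S0)).
  split=> [[S eqS nS]|]; last by exists S0.
  suff -> : S0 = S by rewrite -eqS in nS *.
  by apply/h_inj/g_inj; rewrite ?inE.
by have nS0 : ~ S0 (g (h S0)) by [move=> S0m; case: (S0P.1 S0m)]; apply/nS0/S0P.
Qed.

Theorem theorem6p8 : ~ countable [set V : set algebra | is_subvariety V M_DM].
Proof.
have [p [p_inj p_odd_prime]] := odd_primes_sequence.
pose V (S : set nat) := M_DM `&` models [set cycle_identity (p i) | i in S].
(* The cyclic algebras in [V S] determine the complement of [S], hence [S] itself, so [V] is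
   injective. *)
have VP S i : V S (cyclic_algebra (p i)) <-> ~ S i.
  have [pi_prime _] := p_odd_prime i.
  have pi_satP j : satisfies (cyclic_algebra (p i)) (cycle_identity (p j)) <->
      i <> j.
    have [pj_prime pj_odd] := p_odd_prime j.
    rewrite cyclic_algebra_cycle_identity ?prime_gt0 // dvdn_prime2 //.
    by rewrite (inj_eq p_inj); split=> /eqP.
  split=> [[_ sat] Si|nSi].
    by have /pi_satP := sat _ (ex_intro2 _ _ i Si erefl).
  split; first exact/cyclic_algebra_M_DM/prime_gt1.
  by move=> _ [j Sj <-]; apply/pi_satP => ij; apply: nSi; rewrite ij.
apply: (@powerset_nat_not_countable _ _ V) => [S S' VSS'|S].
  apply/seteqP; split=> i Si; apply: contrapT => nSi.
  - by move: Si; apply/VP; rewrite VSS'; apply/VP.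
  - by move: Si; apply/VP; rewrite -VSS'; apply/VP.
exact/subvariety_cut/M_DM_variety.
Qed.
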